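(* Let $n\ge 1$, $M>0$, let $C=\{c_1,\dots,c_k\}$ ($k\ge 1$) be a finite set with the discrete metric, and let $N:[-M,M]^n\to C$ be an arbitrary function (a classifier). Let $A_N:\mathbb{K}[-M,M]^n\to\mathbb{K}C$ be the reachability map $A_N(X)=\bigcap\{D\in\mathbb{K}C\mid N(X)\subseteq D\}$. Then $A_N$ has a tightest robust approximation $A_N^{\circledcirc}:\mathbb{K}[-M,M]^n\to\mathbb{K}C$, which is also Scott-continuous.
   Context: For a compact metric space $S$, $\mathbb{K}S$ is the set of non-empty compact subsets of $S$ ordered by reverse inclusion: $X\sqsubseteq Y\iff Y\subseteq X$. It is a pointed directed-complete partial order (dcpo) with bottom element $S$. Here $[-M,M]^n$ carries the Euclidean topology with the metric induced by the max norm, and $C$ carries the discrete metric ($d(x,y)=1$ if $x\ne y$), so $\mathbb{K}C$ is the set of non-empty subsets of $C$. For $X\subseteq S$ and $\delta>0$ let $B(X,\delta)=\{y\in S\mid \exists x\in X: d(x,y)<\delta\}$. A subset $U\subseteq\mathbb{K}S$ is robust open iff for every $K\in U$ there is $\delta>0$ such that every $K'\in\mathbb{K}S$ with $K'\subseteq B(K,\delta)$ belongs to $U$. The robust open sets form the robust topology. For compact metric spaces $S_1,S_2$, a map $\mathbb{K}S_1\to\mathbb{K}S_2$ is robust iff it is continuous with respect to the robust topologies. A robust approximation of a monotone map $f:\mathbb{K}S_1\to\mathbb{K}S_2$ is a robust map $g:\mathbb{K}S_1\to\mathbb{K}S_2$ with $g\sqsubseteq f$ pointwise, i.e. $f(X)\subseteq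 g(X)$ for all $X$. The tightest robust approximation is the largest one in the pointwise order $\sqsubseteq$. Scott-continuous means continuous with respect to the Scott topologies (equivalently, monotone and preserving suprema of directed sets). *)

(* Defs.v *)
From HB Require Import structures.
From mathcomp Require Import all_boot all_order all_algebra.
From mathcomp Require Import all_classical all_reals all_analysis.

Set Implicit Arguments.
Unset Strict Implicit.
Unset Printing Implicit Defensive.

Import Order.TTheory GRing.Theory Num.Theory.
Import numFieldNormedType.Exports.

Local Open Scope classical_set_scope.
Local Open Scope ring_scope.

(* The norm of ['M[R]_(m, n)] is the max norm [mx_norm]; its balls are the
   balls of the pseudometric already attached to matrices. *)
Section max_metric.
Variables (R : realType) (m n : nat).
Implicit Types x y : 'M[R]_(m, n).

Let mx_dist x y : R := `|x - y|.

Let mx_dist_ge0 x y : 0 <= mx_dist x y.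
Proof. exact: normr_ge0. Qed.

Let mx_dist_positivity x y : mx_dist x y = 0 -> x = y.
Proof. by move/normr0_eq0/eqP; rewrite subr_eq0 => /eqP. Qed.

Let mx_ballE x d : ball x d = [set y | mx_dist x y < d].
Proof. by rewrite mx_norm_ball. Qed.

HB.instance Definition _ := PseudoMetric_isMetric.Build R 'M[R]_(m, n)
  mx_dist_ge0 mx_dist_positivity mx_ballE.

End max_metric.

Section subspace_metric.
Variables (R : realType) (X : metricType R) (A : set X).
Implicit Types x y : set_type A.

Let sub_dist x y : R := mdist (val x) (val y).

Let sub_dist_ge0 x y : 0 <= sub_dist x y.
Proof. exact: mdist_ge0. Qed.

Let sub_dist_positivity x y : sub_dist x y = 0 -> x = y.
Proof. by move/mdist_positivity/val_inj. Qed.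

Let sub_ballE x d : ball x d = [set y | sub_dist x y < d].
Proof.
transitivity (val @^-1` ball (val x) d : set (set_type A)); first by [].
by rewrite ballEmdist.
Qed.

HB.instance Definition _ := PseudoMetric_isMetric.Build R (set_type A)
  sub_dist_ge0 sub_dist_positivity sub_ballE.

End subspace_metric.

(* The pseudometric of [discrete_topology] has singletons as balls of every
   radius, which is not the metric d(x,y) = 1 for x <> y; hence this alias. *)
Definition discrete_space (R : realType) (C : Type) : Type := C.

HB.instance Definition _ (R : realType) (C : finType) :=
  Finite.copy (discrete_space R C) C.

Section discrete_metric.
Variables (R : realType) (C : finType).
Implicit Types x y z : discrete_space R C.

Let discr_dist x y : R := (x != y)%:R.

Let discr_distxx x : discr_dist x x = 0.
Proof. by rewrite /discr_dist eqxx. Qed.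

Let discr_dist_positivity x y : discr_dist x y = 0 -> x = y.
Proof. by rewrite /discr_dist; case: eqVneq => //= _ /eqP; rewrite oner_eq0. Qed.

Let discr_dist_sym x y : discr_dist x y = discr_dist y x.
Proof. by rewrite /discr_dist eq_sym. Qed.

Let discr_dist_triangle y x z :
  discr_dist x z <= discr_dist x y + discr_dist y z.
Proof.
rewrite /discr_dist -natrD ler_nat.
by case: (eqVneq x y) => [->|]; case: (eqVneq y z) => // _ _; case: (_ != _).
Qed.

HB.instance Definition _ := isMetric.Build R (discrete_space R C)
  discr_distxx discr_dist_positivity discr_dist_sym discr_dist_triangle.

End discrete_metric.

Definition cube (R : realType) (n : nat) (M : R) : set 'rV[R]_n :=
  [set x | forall i, x ord0 i \in `[- M, M]].

Arguments cube {R} n M.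

Lemma mdist_cube (R : realType) (n : nat) (M : R) (x y : set_type (cube n M)) :
  mdist x y = mx_norm (val x - val y).
Proof. by []. Qed.

Lemma mdist_discrete (R : realType) (C : finType) (x y : discrete_space R C) :
  mdist x y = (x != y)%:R.
Proof. by []. Qed.

Lemma compact_cube (R : realType) (n : nat) (M : R) :
  compact [set: set_type (cube n M)].
Proof.
have cM : compact (cube n M).
  apply: (@rV_compact R n (fun=> [set` `[- M, M]])) => _.
  exact: segment_compact.
move=> F FF _.
have [|p [cp Fp]] := cM (val @ F) _.
  by apply: (@filterE _ F) => -[x cx]; exact: set_mem cx.
exists (exist _ p (mem_set cp)); split=> // A B FA [_ [[U oU <-] Up UB]].
have FvA : (val @ F) (val @` A) by apply: (@filterS _ F _ A) FA => x Ax; exists x.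
have [_ [[x Ax <-] Ux]] := Fp _ _ FvA (open_nbhs_nbhs (conj oU Up)).
by exists x; split=> //; exact: UB.
Qed.

Record compacts (S : topologicalType) := Compacts {
  compacts_set :> set S;
  compacts_neq0 : compacts_set !=set0;
  compactsP : compact compacts_set
}.

Lemma compacts_inj (S : topologicalType) (X Y : compacts S) :
  (X : set S) = Y -> X = Y.
Proof.
case: X Y => [X X0 cX] [Y Y0 cY] /= XY; subst Y.
by rewrite (Prop_irrelevance X0 Y0) (Prop_irrelevance cX cY).
Qed.

HB.instance Definition _ (S : topologicalType) := gen_eqMixin (compacts S).
HB.instance Definition _ (S : topologicalType) := gen_choiceMixin (compacts S).

Fact compacts_display : Order.disp_t. Proof. exact: Order.Disp tt tt. Qed.

Section reverse_inclusion.
Variable S : topologicalType.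
Implicit Types X Y Z : compacts S.

Let compacts_le X Y := `[< Y `<=` X >].

Let compacts_le_refl : reflexive compacts_le.
Proof. by move=> X; apply/asboolP. Qed.

Let compacts_le_anti : antisymmetric compacts_le.
Proof.
move=> X Y /andP[/asboolP YX /asboolP XY].
by apply: compacts_inj; apply/seteqP.
Qed.

Let compacts_le_trans : transitive compacts_le.
Proof.
move=> Y X Z /asboolP YX /asboolP ZY; apply/asboolP.
exact: subset_trans ZY YX.
Qed.

HB.instance Definition _ := Order.Le_isPOrder.Build compacts_display
  (compacts S) compacts_le_refl compacts_le_anti compacts_le_trans.

Lemma compacts_leP X Y : reflect (Y `<=` X) (X <= Y)%O.
Proof. exact: asboolP. Qed.

End reverse_inclusion.

Section robust_topology.
Variables (R : realType) (S : metricType R).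

Definition enlarge (X : set S) (delta : R) : set S :=
  [set y | exists2 x, X x & mdist x y < delta].

Definition robust_open (U : set (compacts S)) :=
  forall K, U K -> exists2 delta : R, 0 < delta &
    forall K' : compacts S, K' `<=` enlarge K delta -> U K'.

Definition robust_space : Type := compacts S.

HB.instance Definition _ := Choice.on robust_space.

Let robust_openT : robust_open setT.
Proof. by move=> K _; exists 1. Qed.

Let robust_openI : setI_closed robust_open.
Proof.
move=> U V oU oV K [/oU[d d0 dU] /oV[e e0 eV]].
exists (Num.min d e); first by rewrite lt_min d0.
move=> K' K'K; split; [apply: dU|apply: eV];
  by move=> y /K'K[x Kx]; rewrite lt_min => /andP[? ?]; exists x.
Qed.

Let robust_open_bigU (I : Type) (f : I -> set (compacts S)) :
  (forall i, robust_open (f i)) -> robust_open (\bigcup_i f i).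
Proof.
move=> of_ K [i _ /of_[d d0 dU]]; exists d => // K' /dU fK'.
by exists i.
Qed.

HB.instance Definition _ := isOpenTopological.Build robust_space
  robust_openT robust_openI robust_open_bigU.

End robust_topology.

Section scott_topology.
Variables (d : Order.disp_t) (P : porderType d).

Definition directed_set (D : set P) :=
  D !=set0 /\
  forall x y, D x -> D y -> exists z, [/\ D z, (x <= z)%O & (y <= z)%O].

Definition scott_open (U : set P) :=
  (forall x y, U x -> (x <= y)%O -> U y) /\
  (forall D s, directed_set D -> supremums D s -> U s ->
    exists2 x, D x & U x).

Definition scott_space : Type := P.

HB.instance Definition _ := Choice.on scott_space.

Let scott_openT : scott_open setT.
Proof. by split=> // D s [[x Dx] _] _ _; exists x. Qed.

Let scott_openI : setI_closed scott_open.
Proof.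
move=> U V [upU inU] [upV inV]; split.
  by move=> x y [Ux Vx] xy; split; [exact: upU xy|exact: upV xy].
move=> D s dD Ds [Us Vs].
have [x Dx Ux] := inU D s dD Ds Us.
have [y Dy Vy] := inV D s dD Ds Vs.
have [z [Dz xz yz]] := dD.2 x y Dx Dy.
by exists z => //; split; [exact: upU xz|exact: upV yz].
Qed.

Let scott_open_bigU (I : Type) (f : I -> set P) :
  (forall i, scott_open (f i)) -> scott_open (\bigcup_i f i).
Proof.
move=> of_; split.
  by move=> x y [i _ fx] xy; exists i => //; exact: (of_ i).1 fx xy.
move=> D s dD Ds [i _ fs].
by have [x Dx fx] := (of_ i).2 D s dD Ds fs; exists x => //; exists i.
Qed.

HB.instance Definition _ := isOpenTopological.Build scott_space
  scott_openT scott_openI scott_open_bigU.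

End scott_topology.

Definition scott_continuous d d' (P : porderType d) (Q : porderType d')
    (f : P -> Q) :=
  continuous (f : scott_space P -> scott_space Q).

Section robust_approximation.
Variables (R : realType) (S1 S2 : metricType R).

Definition robust (f : compacts S1 -> compacts S2) :=
  continuous (f : robust_space S1 -> robust_space S2).

Variable f : {omorphism compacts S1 -> compacts S2}.

Definition robust_approximation (g : compacts S1 -> compacts S2) :=
  robust g /\ forall X, (g X <= f X)%O.

Definition tightest_robust_approximation (g : compacts S1 -> compacts S2) :=
  robust_approximation g /\
  forall h, robust_approximation h -> forall X, (h X <= g X)%O.

End robust_approximation.

Section reachability.
Variables (R : realType) (S : metricType R) (C : finType) (N : S -> C).
Local Notation KC := (compacts (discrete_space R C)).

Definition reach_set (X : set S) : set (discrete_space R C) :=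
  \bigcap_(D in [set D : KC | N @` X `<=` D]) D.

Lemma reach_set_neq0 (X : set S) : X !=set0 -> reach_set X !=set0.
Proof. by move=> [x Xx]; exists (N x) => D /(_ (N x)); apply; exists x. Qed.

Lemma compact_discrete (D : set (discrete_space R C)) : compact D.
Proof. exact/finite_compact/finite_finset. Qed.

Definition reachability (X : compacts S) : KC :=
  Compacts (reach_set_neq0 (compacts_neq0 X)) (@compact_discrete (reach_set X)).

Let reachability_homo :
  {homo reachability : X Y / (X <= Y)%O >-> (X <= Y)%O}.
Proof.
move=> X Y /compacts_leP YX; apply/compacts_leP => c Yc D /= ND.
by apply: Yc; apply: subset_trans ND; exact: image_subset.
Qed.

HB.instance Definition _ :=
  Order.isOrderMorphism.Build _ (compacts S) _ KC reachability
    reachability_homo.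

End reachability.

(* Main.v *)
Require Import Defs.
From mathcomp Require Import all_boot all_order all_algebra.
From mathcomp Require Import all_classical all_reals all_analysis.

Import numFieldNormedType.Exports.

Local Open Scope ring_scope.

(** The tightest robust approximation sends [X] to the set of classes whose
    regions come arbitrarily close to [X]. As there are finitely many classes,
    some [delta] separates [X] from the regions of all the classes outside this
    set, so enlarging [X] by [delta / 2] adds no class: this gives robustness.
    A supremum of a directed family is its intersection, and by compactness
    some member lies in any given enlargement of it, whence Scott continuity.
    A robust approximation [h] satisfies [h K <= h X] for every [K] close to
    [X], in particular for singletons, so [h X] contains every class occurring
    near [X]. *)

Section RobustReachability.
Set Implicit Arguments.
Unset Strict Implicit.
Import Order.TTheory GRing.Theory Num.Theory.
Local Open Scope classical_set_scope.
Local Open Scope ring_scope.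

Lemma sub_enlarge (R : realType) (S : metricType R) (X : set S) (e : R) :
  0 < e -> X `<=` enlarge X e.
Proof. by move=> e0 x Xx; exists x; rewrite ?mdistxx. Qed.

Lemma enlarge_sub (R : realType) (S : metricType R) (X Y : set S) (e : R) :
  X `<=` Y -> enlarge X e `<=` enlarge Y e.
Proof. by move=> XY y [x /XY Yx xy]; exists x. Qed.

Lemma le_enlarge (R : realType) (S : metricType R) (X : set S) (d e : R) :
  d <= e -> enlarge X d `<=` enlarge X e.
Proof. by move=> de y [x Xx xy]; exists x => //; exact: lt_le_trans xy de. Qed.

Lemma enlarge_enlarge (R : realType) (S : metricType R) (X : set S) (d e : R) :
  enlarge (enlarge X d) e `<=` enlarge X (d + e).
Proof.
move=> z [y [x Xx xy] yz]; exists x => //.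
by apply: le_lt_trans (metric_triangle x y z) _; exact: ltrD.
Qed.

Lemma robustP (R : realType) (S1 S2 : metricType R)
    (f : compacts S1 -> compacts S2) :
  robust f <-> forall U, robust_open U -> robust_open (f @^-1` U).
Proof. exact: continuousP. Qed.

Lemma scott_continuousP d d' (P : porderType d) (Q : porderType d')
    (f : P -> Q) :
  scott_continuous f <-> forall U, scott_open U -> scott_open (f @^-1` U).
Proof. exact: continuousP. Qed.

Definition singleton_compact (S : topologicalType) (x : S) : compacts S :=
  Compacts (ex_intro [set x] x erefl) (@compact_set1 S x).

(** Otherwise the sets [X \ enlarge K e], for [X] in [D], form the base of a proper filter, which
    has a cluster point [p] by compactness. This [p] lies in [K], yet its [e]-ball meets the
    complement of [enlarge K e]. *)
Lemma directed_supremum_enlarge (R : realType) (S : metricType R)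
    (D : set (compacts S)) (K : compacts S) (e : R) :
  compact [set: S] -> directed_set D -> supremums D K -> 0 < e ->
  exists2 X, D X & X `<=` enlarge K e.
Proof.
move=> cS [[X0 DX0] dD] [_ lubK] e0; apply: contrapT => nsub.
pose F := filter_from D (fun X => X `\` enlarge K e).
have FF : Filter F.
  apply: filter_from_filter; first by exists X0.
  move=> X Y DX DY.
  have [Z [DZ /compacts_leP ZX /compacts_leP ZY]] := dD _ _ DX DY.
  by exists Z => // z [Zz nKz]; split; split => //; [exact: ZX|exact: ZY].
have PF : ProperFilter F.
  apply: filter_from_proper => X DX; apply: contrapT => XK0; apply: nsub.
  exists X => // x Xx; apply: contrapT => nKx; apply: XK0.
  by exists x.
have [p [_ Fp]] := cS F PF filterT.
have Dp X : D X -> (X : set S) p.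
  move=> DX; have := compact_closed (@metric_hausdorff R S) (@compactsP S X).
  apply=> B Bp.
  by apply: Fp Bp; exists X => // x [].
have Kp : (K : set S) p.
  (* As [p] lies in every member of [D], the singleton of [p] is an upper bound of [D], hence above
     [K]. *)
  have /compacts_leP : (K <= singleton_compact p)%O.
    by apply: lubK => X DX; apply/compacts_leP => _ ->; exact: Dp.
  exact.
have [|q [[_ nKq] pq]] := Fp (X0 `\` enlarge K e) (ball p e) _
    (nbhsx_ballx _ _ e0).
  by exists X0.
by apply: nKq; exists p => //; rewrite ballEmdist in pq.
Qed.

(** For compact [X] these are the classes [c] such that the closure of the region [N = c] meets [X].
    The form with enlargements also suits sets that need not be compact, such as [enlarge X e]. *)
Definition limit_classes (R : realType) (S : metricType R) (C : finType)
    (N : S -> C) (X : set S) : set (discrete_space R C) :=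
  [set c | forall e : R, 0 < e -> exists2 y, enlarge X e y & N y = c].

Lemma image_sub_limit_classes (R : realType) (S : metricType R) (C : finType)
  (N : S -> C) (X : set S) : N @` X `<=` limit_classes N X.
Proof. by move=> _ [x Xx <-] e e0; exists x => //; exact: sub_enlarge. Qed.

Lemma limit_classes_neq0 (R : realType) (S : metricType R) (C : finType)
  (N : S -> C) (X : set S) : X !=set0 -> limit_classes N X !=set0.
Proof.
by move=> [x Xx]; exists (N x); apply: image_sub_limit_classes; exists x.
Qed.

Lemma limit_classes_sub (R : realType) (S : metricType R) (C : finType)
    (N : S -> C) (X Y : set S) :
  X `<=` Y -> limit_classes N X `<=` limit_classes N Y.
Proof.
by move=> XY c Xc e /Xc[y Xy <-]; exists y => //; exact: enlarge_sub Xy.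
Qed.

Lemma limit_classes_enlarge (R : realType) (S : metricType R) (C : finType)
    (N : S -> C) (X : set S) :
  exists2 e : R, 0 < e & limit_classes N (enlarge X e) `<=` limit_classes N X.
Proof.
have sep c : exists e : R, 0 < e /\
    ((exists2 y, enlarge X e y & N y = c) -> limit_classes N X c).
  (* For a limit class any radius will do. *)
  have [Xc|] := pselect (limit_classes N X c); first by exists 1; split.
  by move=> /existsNP[e /not_implyP[e0 Xe]]; exists e; split.
pose e c := projT1 (cid (sep c)).
pose m : R := \big[Num.min/1]_(c : C) e c.
have m0 : 0 < m.
  by apply: lt_bigmin => // c _; rewrite /e; case: cid => ? [].
(* One half of [m] is spent on enlarging [X], the other on testing for limit classes. *)
exists (m / 2); first by rewrite divr_gt0.
move=> c /(_ (m / 2))[|y Xy Nyc]; first by rewrite divr_gt0.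
have := (projT2 (cid (sep c))).2; apply; exists y => //.
apply: (@le_enlarge _ _ _ m); first exact: bigmin_le_cond.
by rewrite [m]splitr; exact: enlarge_enlarge Xy.
Qed.

Definition limit_reachability (R : realType) (S : metricType R) (C : finType)
    (N : S -> C) (X : compacts S) : compacts (discrete_space R C) :=
  Compacts (@limit_classes_neq0 R S C N X (compacts_neq0 X))
    (@compact_discrete R C (limit_classes N X)).

Lemma limit_reachability_robust (R : realType) (S : metricType R) (C : finType)
  (N : S -> C) : robust (limit_reachability N).
Proof.
apply/robustP => U oU K UK; have [d d0 dU] := oU _ UK.
have [e e0 eK] := limit_classes_enlarge N K.
exists e => // K' K'K; apply: dU.
apply: subset_trans (sub_enlarge d0).
by apply: subset_trans eK; exact: limit_classes_sub.
Qed.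

Lemma limit_reachability_scott (R : realType) (S : metricType R) (C : finType)
  (N : S -> C) :
  compact [set: S] -> scott_continuous (limit_reachability N).
Proof.
move=> cS; apply/scott_continuousP => U [upU _]; split.
  move=> X Y UX /compacts_leP YX; apply: upU UX _.
  by apply/compacts_leP; exact: limit_classes_sub.
move=> D K dD DK UK; have [e e0 eK] := limit_classes_enlarge N K.
have [X DX XK] := directed_supremum_enlarge cS dD DK e0.
exists X => //; apply: upU UK _; apply/compacts_leP.
by apply: subset_trans eK; exact: limit_classes_sub.
Qed.

Lemma limit_reachability_tightest (R : realType) (S : metricType R)
    (C : finType) (N : S -> C) :
  tightest_robust_approximation (reachability N) (limit_reachability N).
Proof.
split.
  split; first exact: limit_reachability_robust.
  (* The set of limit classes is itself one of the sets intersected in [reach_set]. *)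
  move=> X; apply/compacts_leP => c; apply.
  exact: image_sub_limit_classes.
move=> h [/robustP ch leh] X; apply/compacts_leP => c Xc.
pose U : set (compacts (discrete_space R C)) := [set Y | Y `<=` h X].
have oU : robust_open U.
  (* Distinct classes are at distance 1, so enlarging by 1 adds nothing. *)
  move=> Y YX; exists 1 => // Y' Y'Y; apply: subset_trans YX.
  move=> b /Y'Y[a Ya]; rewrite mdist_discrete.
  by case: eqVneq => [<-//|_]; rewrite ltxx.
have [e e0 eX] := ch U oU X (@subset_refl _ _).
have [y Xy Nyc] := Xc e e0.
(* It remains to see that [h] at the singleton of [y] contains [c = N y], which holds because [h]
   approximates [reachability N]. *)
apply: (eX (singleton_compact y)) => [_ ->//|].
have /compacts_leP := leh (singleton_compact y); apply.
by move=> B; apply; exists y.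
Qed.

End RobustReachability.

Theorem theorem3p5 (R : realType) (n : nat) (M : R) (C : finType)
    (n_ge1 : (1 <= n)%N) (M_gt0 : 0 < M) (C_gt0 : (1 <= #|C|)%N)
    (N : set_type (cube n M) -> C) :
  exists A : compacts (set_type (cube n M)) -> compacts (discrete_space R C),
    tightest_robust_approximation (reachability N) A /\ scott_continuous A.
Proof.
exists (limit_reachability N); split.
  exact: limit_reachability_tightest.
exact/limit_reachability_scott/compact_cube.
Qed.
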